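(* Let $S=\{S_1,S_2,\dots,S_m\}$ be a set of $n\times n$ real matrices. Then $S$ is simultaneously skewable if and only if there exists a positive definite symmetric real $n\times n$ matrix $A$ such that $$S_iA+AS_i^T=0\quad\text{for all } 1\le i\le m.$$ Moreover, if such a positive definite symmetric solution $A$ exists, then there is always a symmetric real matrix $U$ such that $U^2=A$, and this matrix $U$ skew-symmetrizes the set $S$.
   Context: A set $S=\{S_1,\dots,S_m\}$ of $n\times n$ real matrices is simultaneously skewable if there exists a nonsingular real $n\times n$ matrix $U$ such that $U^{-1}S_kU$ is skew-symmetric for every $1\le k\le m$; such a nonsingular $U$ is said to skew-symmetrize the set $S$. *)

(* Defs.v *)
From mathcomp Require Import all_boot all_order all_algebra.
From mathcomp Require Import reals.

Set Implicit Arguments.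
Unset Strict Implicit.
Unset Printing Implicit Defensive.

Import Order.TTheory GRing.Theory Num.Theory.
Local Open Scope ring_scope.

(* No symmetry of A is built in. *)
Definition posdefmx (R : realType) (n : nat) (A : 'M[R]_n) : Prop :=
  forall x : 'cV[R]_n, x != 0 -> 0 < (x^T *m A *m x) 0 0.

Definition skew_symmetrizes (R : realType) (n m : nat)
    (U : 'M[R]_n) (S : 'I_m -> 'M[R]_n) : Prop :=
  U \in unitmx /\ forall k : 'I_m, invmx U *m S k *m U \is skewmx.

Definition simultaneously_skewable (R : realType) (n m : nat)
    (S : 'I_m -> 'M[R]_n) : Prop :=
  exists U : 'M[R]_n, skew_symmetrizes U S.

(* symmetricmx and skewmx are the instances (false, idfun) and (true, idfun)
   of hermitianmx; these two lemmas give their usual form. *)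
Lemma symmetricmx_trE (R : realType) (n : nat) (A : 'M[R]_n) :
  (A \is symmetricmx) = (A^T == A).
Proof. by rewrite is_hermitianmxE expr0 scale1r map_mx_id // eq_sym. Qed.

Lemma skewmx_trE (R : realType) (n : nat) (A : 'M[R]_n) :
  (A \is skewmx) = (A^T == - A).
Proof.
by rewrite is_hermitianmxE expr1 scaleN1r map_mx_id // -eqr_oppLR eq_sym.
Qed.

(* Main.v *)
(** If [U^-1 S U] is skew then [A = U U^T] solves [S A + A S^T = 0]; conversely,
    if [A = U^2] with [U] symmetric, multiplying the equation by [U^-1] on both
    sides says that [U^-1 S U] is skew. The square root of a positive definite
    symmetric [A] is [q(A)], where the real polynomial [q] interpolates the
    square root at the eigenvalues of [A]: symmetry and reality of [q(A)] are
    then automatic, and [q(A)^2 = A] may be checked after diagonalizing [A]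
    over the complex numbers. *)
Require Import Defs.
From mathcomp Require Import all_boot all_order all_algebra.
From mathcomp Require Import reals complex.

Import Order.TTheory GRing.Theory Num.Theory.
Local Open Scope ring_scope.

Lemma poly_interpolation (F : fieldType) (f : F -> F) (s : seq F) :
  exists q : {poly F}, {in s, forall x, q.[x] = f x}.
Proof.
elim: s => [|a s [q qP]]; first by exists 0.
have [as_|aNs] := boolP (a \in s).
  by exists q => x /[!inE] /predU1P[->|]; exact: qP.
pose w := \prod_(y <- s) ('X - y%:P).
have wa : w.[a] != 0 by rewrite -[_ == _]/(root w a) root_prod_XsubC.
(* Newton step: [w] vanishes on [s] but not at [a], so the added multiple of [w] corrects the value
   at [a] and keeps the earlier ones. *)
exists (q + ((f a - q.[a]) / w.[a]) *: w) => x /[!inE] /predU1P[->|xs].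
  by rewrite !hornerE divfK // addrC subrK.
have /eqP wx : root w x by rewrite root_prod_XsubC.
by rewrite !hornerE wx mulr0 addr0 qP.
Qed.

Lemma trmx_horner_mx (F : comNzRingType) (n : nat) (A : 'M[F]_n.+1)
    (q : {poly F}) : (horner_mx A q)^T = horner_mx A^T q.
Proof.
elim/poly_ind: q => [|q c IHq]; first by rewrite !raddf0.
rewrite !rmorphD !rmorphM /= !horner_mx_X !horner_mx_C linearD /= tr_scalar_mx.
congr (_ + _); rewrite [LHS]trmx_mul IHq; exact/comm_mx_horner.
Qed.

(** A row eigenvector [v] gives [v A v^T = a (v v^T)], which is positive, while [v v^T] is a sum of
    squares; this excludes [a <= 0]. *)
Lemma posdef_eigenvalue_gt0 (R : realType) (n : nat) (A : 'M[R]_n) (a : R) :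
  posdefmx A -> eigenvalue A a -> 0 < a.
Proof.
move=> Apos /eigenvalueP[v vA vN0].
have := Apos v^T; rewrite trmxK trmx_eq0 vA -scalemxAl => /(_ vN0).
rewrite mxE => avv; have vv : 0 <= (v *m v^T) 0 0.
  by rewrite mxE sumr_ge0 // => j _; rewrite mxE -expr2 sqr_ge0.
by move: avv; rewrite ltNge; case: (ltP 0 a) => // a0; rewrite mulr_le0_ge0.
Qed.

(** Over [R[i]] the matrix becomes Hermitian, so the spectral theorem applies and the spectrum is
    real. Keeping [d] over [R] lets real square roots be taken of its entries. *)
Lemma symmetric_diagonalization (R : realType) (n : nat) (A : 'M[R]_n) :
  A \is symmetricmx ->
  exists (P : 'M[R[i]]_n) (d : 'rV[R]_n), P \in unitmx /\
    map_mx (real_complex R) A =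
      invmx P *m diag_mx (map_mx (real_complex R) d) *m P.
Proof.
rewrite symmetricmx_trE => /eqP Asym.
pose B := map_mx (real_complex R) A.
have Bherm : B \is hermsymmx.
  apply/is_hermitianmxP; rewrite expr0 scale1r map_trmx Asym.
  apply/matrixP => i j; rewrite !mxE. exact/esym/conjc_real.
have dreal := hermitian_spectral_diag_real Bherm.
exists (spectralmx B), (map_mx (@complex.Re R) (spectral_diag B)).
split; first exact: spectral_unit.
rewrite (_ : map_mx _ (map_mx _ _) = spectral_diag B).
  exact/orthomx_spectralP/hermitian_normalmx.
apply/matrixP => i j; rewrite !mxE; exact/RRe_real/mxOverP.
Qed.

Lemma diagonalization_eigenvalue (F : fieldType) (n : nat) (P : 'M[F]_n)
    (d : 'rV[F]_n) (i : 'I_n) :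
  P \in unitmx -> eigenvalue (invmx P *m diag_mx d *m P) (d 0 i).
Proof.
(* Row [i] of [P] is a left eigenvector, since [P (P^-1 D P) = D P]; it is nonzero because [P] is
   invertible. *)
move=> Pu; apply/eigenvalueP; exists (row i P); last first.
  apply: contraTneq Pu => Pi0.
  rewrite -row_free_unit; apply/negP => /row_freeP[Q /(congr1 (row i))].
  rewrite row_mul Pi0 mul0mx => /rowP/(_ i)/eqP.
  by rewrite !mxE eqxx eq_sym oner_eq0.
rewrite -row_mul !mulmxA mulmxV // mul1mx row_mul.
by rewrite row_diag_mx -scalemxAl -rowE.
Qed.

Lemma posdef_sqrtmx (R : realType) (n : nat) (A : 'M[R]_n) :
  A \is symmetricmx -> posdefmx A ->
  exists U : 'M[R]_n, U \is symmetricmx /\ U *m U = A.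
Proof.
case: n A => [|n] A Asym Apos.
  (* Polynomials are evaluated at matrices of size [n.+1] only; in size 0 all matrices coincide. *)
  by exists A; split => //; apply/matrixP => -[].
have [P [d [Pu AE]]] := symmetric_diagonalization R _ A Asym.
have d_gt0 i : 0 < d 0 i.
  apply: (posdef_eigenvalue_gt0 R _ A) => //.
  rewrite -(eigenvalue_map (real_complex R)) AE.
  by have := diagonalization_eigenvalue _ _ P (map_mx (real_complex R) d) i Pu;
     rewrite mxE.
have [q qP] := poly_interpolation R Num.sqrt [seq d 0 i | i : 'I_n.+1].
exists (horner_mx A q); split.
  rewrite symmetricmx_trE trmx_horner_mx.
  by move: Asym; rewrite symmetricmx_trE => /eqP->.
(* With [A] read as ['X] evaluated at [A], both sides are polynomials in [A]; after diagonalization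
   it suffices that [q * q] and ['X] agree at each [d 0 i]. *)
rewrite -[RHS]horner_mx_X -[LHS](rmorphM (horner_mx A)).
apply: (map_mx_inj (f := real_complex R)); rewrite !map_horner_mx AE.
rewrite !horner_mx_uconjC // !horner_mx_diag; congr (_ *m diag_mx _ *m _).
apply/rowP => i; rewrite !mxE !horner_map /=; congr (real_complex R _).
by rewrite hornerM hornerX qP ?image_f // -expr2 sqr_sqrtr // ltW.
Qed.

(** If [v A^T = 0] then [A v^T = 0], so the quadratic form vanishes at [v^T], forcing [v = 0]. *)
Lemma posdefmx_unit (R : realType) (n : nat) (A : 'M[R]_n) :
  posdefmx A -> A \in unitmx.
Proof.
move=> Apos; rewrite -unitmx_tr -row_free_unit -kermx_eq0.
apply/rowV0P => v /sub_kermxP vA; apply/eqP/negPn/negP => vN0.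
have := Apos v^T; rewrite trmxK trmx_eq0 -mulmxA -[A *m _]trmxK trmx_mul trmxK.
by rewrite vA trmx0 mulmx0 mxE ltxx => /(_ vN0).
Qed.

(** The form at [x] is the sum of the squared entries of [x^T U], a nonzero row since [U] is
    invertible. *)
Lemma posdef_mulmx_tr (R : realType) (n : nat) (U : 'M[R]_n) :
  U \in unitmx -> posdefmx (U *m U^T).
Proof.
move=> Uu x xN0; rewrite mulmxA -mulmxA -{2}[x]trmxK -trmx_mul mxE.
set v := x^T *m U.
have /rV0Pn[i vi] : v != 0.
  apply: contraNneq xN0 => v0.
  by rewrite -trmx_eq0 -[x^T](mulmxK Uu) -/v v0 mul0mx.
move: v vi => v vi.
rewrite (bigD1 i) //= mxE ltr_pwDl //; first by rewrite -expr2 exprn_even_gt0.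
by rewrite sumr_ge0 // => j _; rewrite mxE -expr2 sqr_ge0.
Qed.

Theorem lemma2p7 (R : realType) (n m : nat) (S : 'I_m -> 'M[R]_n) :
  (simultaneously_skewable S <->
     exists A : 'M[R]_n,
       [/\ A \is symmetricmx, posdefmx A
         & forall i : 'I_m, S i *m A + A *m (S i)^T = 0])
  /\
  (forall A : 'M[R]_n,
     A \is symmetricmx -> posdefmx A ->
     (forall i : 'I_m, S i *m A + A *m (S i)^T = 0) ->
     (exists U : 'M[R]_n, U \is symmetricmx /\ U *m U = A)
     /\
     (forall U : 'M[R]_n,
        U \is symmetricmx -> U *m U = A -> skew_symmetrizes U S)).
Proof.
have skewP (A U : 'M[R]_n) : posdefmx A ->
    (forall i : 'I_m, S i *m A + A *m (S i)^T = 0) ->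
    U \is symmetricmx -> U *m U = A -> skew_symmetrizes U S.
  move=> Apos SA; rewrite symmetricmx_trE => /eqP Usym UUA.
  have Uu : U \in unitmx.
    by have := posdefmx_unit R n A Apos; rewrite -UUA unitmx_mul => /andP[].
  split=> // k; rewrite skewmx_trE -addr_eq0 !trmx_mul trmx_inv Usym addrC.
  (* [U^-1 (S U^2 + U^2 S^T) U^-1 = U^-1 S U + U S^T U^-1], and the last term is the transpose of
     [U^-1 S U]. *)
  have /(congr1 (fun M => invmx U *m M *m invmx U)) := SA k.
  rewrite mulmx0 mul0mx mulmxDr mulmxDl -UUA !mulmxA mulVmx // mul1mx.
  by rewrite mulmxK // => ->.
split; last first.
  by move=> A Asym Apos SA; split=> [|U]; [exact: posdef_sqrtmx | exact: skewP].
split=> [[U [Uu Uskew]]|[A [Asym Apos SA]]]; last first.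
  have [U [Usym UUA]] := posdef_sqrtmx R n A Asym Apos.
  by exists U; exact: skewP UUA.
exists (U *m U^T); split; last 1 first.
- move=> i; have := Uskew i; rewrite skewmx_trE -addr_eq0 addrC => /eqP.
  (* Multiplying by [U] on the left and [U^T] on the right cancels both inverses and leaves
     [S U U^T + U U^T S^T = 0]. *)
  move=> /(congr1 (fun M => U *m M *m U^T)).
  rewrite mulmx0 mul0mx mulmxDr mulmxDl !trmx_mul trmx_inv !mulmxA mulmxV //.
  by rewrite mul1mx mulmxKV ?unitmx_tr.
- by rewrite symmetricmx_trE trmx_mul trmxK.
- exact: posdef_mulmx_tr.
Qed.
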